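(* Consider the problem $\min f(x)$ subject to $Ax=b$, $x\in\mathcal{X}$, where $x\in\mathbb{R}^n$, $A\in\mathbb{R}^{p\times n}$, $b\in\mathbb{R}^p$, the set $\mathcal{X}\subset\mathbb{R}^n$ is convex, and $f$ is a scalar-valued convex function, not necessarily differentiable. Suppose that the problem is feasible and that strong duality holds: $f(x^\star)=\Phi(\lambda^\star)$, where $x^\star$ is an optimal solution of the problem and $\lambda^\star$ is an optimal solution of the dual problem. Let $D\subset\mathbb{R}^p$ be a compact box that contains $0$, $2\lambda^\star$ and $\lambda^\star+\mathbf{1}$, where $\mathbf{1}$ is the all-ones vector. Let $\tilde{x}_k$, $\lambda_k$ be generated by the inexact augmented Lagrangian method described in the context, with errors uniformly bounded: $0\le\epsilon_{in}^k\le B_{in}$ and $\|\epsilon_{out}^k\|\le B_{out}$ for all $k$. Define $\bar{x}_K=\frac1K\sum_{k=1}^K\tilde{x}_k$. Then, with $r$, $\phi^1$ and $E$ as defined in the context: (a) (primal optimality) $$-\Big(\frac1K\phi^1(2\lambda^\star)+E\Big)\le f(\bar{x}_K)-f(x^\star)\le\frac1K\phi^1(0)+E;$$ (b) (primal feasibility) $$\|r(\bar{x}_K)\|\le\frac1K\phi^1\Big(\lambda^\star+\frac{r(\bar{x}_K)}{\|r(\bar{x}_K)\|}\Big)+E.$$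
   Context: $\|\cdot\|$ is the Euclidean norm and $\langle\cdot,\cdot\rangle$ the inner product. The Lagrangian is $L(x;\lambda)=f(x)+\langle Ax-b,\lambda\rangle$ for $\lambda\in\mathbb{R}^p$, the dual function is $\Phi(\lambda)=\min_{x\in\mathcal{X}}L(x;\lambda)$, and the dual problem is $\max_{\lambda\in\mathbb{R}^p}\Phi(\lambda)$. The augmented Lagrangian is $L_\rho(x;\lambda)=f(x)+\langle Ax-b,\lambda\rangle+\frac{\rho}{2}\|Ax-b\|^2$, where $\rho>0$ is the penalty parameter. Inexact augmented Lagrangian method: set $L=\frac{2}{\rho}$ and initialize $\lambda_0\in\mathbb{R}^p$. At each iteration $k=0,1,2,\dots$: (1) find $\tilde{x}_k\in\mathcal{X}$ with $L_\rho(\tilde{x}_k;\lambda_k)-L_\rho(x_k^\star;\lambda_k)\le\epsilon_{in}^k$, where $x_k^\star=\arg\min_{x\in\mathcal{X}}L_\rho(x;\lambda_k)$; (2) set $\lambda_{k+1}=\Pi_D\big[\lambda_k+\frac1L(A\tilde{x}_k-b+\epsilon_{out}^k)\big]$, where $\Pi_D$ is the projection onto $D$ and $\epsilon_{out}^k\in\mathbb{R}^p$ is an error vector. Let $D_\delta=D\cup\{\lambda+\epsilon_{out}^k:\lambda\in D\}$ (over the iterations $k$), and let $B_\lambda$ be a constant with $\|\lambda_1-\lambda_2\|\le B_\lambda$ for all $\lambda_1,\lambda_2\in D_\delta$. Residual: $r(x)=Ax-b$. Merit function: $\phi^k(\lambda)=\frac{L}{2}\|\lambda_k-\lambda\|^2+\frac12\|\lambda_{k-1}-\lambda^\star\|^2$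 for $k\ge1$. Error constant: $$E=\Big(1+\frac4L\Big)B_\lambda B_{out}+\Big(1+\frac4L\Big)B_{in}+\Big(\frac12+\frac1{2L}\Big)B_{out}^2.$$
   Formalization: Part (b) is proved under the additional assumption that the box D also contains λ* − 1 (all-ones vector); without it (b) is false, e.g. f = 0, X = R, A = 1, b = 0, D = [0,1], ρ = 1, λ_0 = 0, all x̃_k = −1/5, errors ε_in = 1/50, ε_out = 0, K = 10. *)

(* Defs.v *)
From mathcomp Require Import all_boot all_order all_algebra.
From mathcomp Require Import all_classical all_reals.
From mathcomp Require Import interval_inference convex ereal.

Set Implicit Arguments.
Unset Strict Implicit.
Unset Printing Implicit Defensive.

Import Order.TTheory GRing.Theory Num.Theory.

Local Open Scope classical_set_scope.
Local Open Scope ring_scope.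

Section Euclidean.
Context {R : realType} {m : nat}.
Implicit Types u v : 'cV[R]_m.

Definition dot u v : R := \sum_(i < m) u i 0 * v i 0.

(* The norm carried by matrices in the library is the sup norm. *)
Definition enorm u : R := Num.sqrt (dot u u).

Definition box (lo hi : 'cV[R]_m) : set 'cV[R]_m :=
  [set v | forall i, lo i 0 <= v i 0 <= hi i 0].

Definition is_projection (D : set 'cV[R]_m) u v : Prop :=
  D v /\ forall w, D w -> enorm (u - v) <= enorm (u - w).

End Euclidean.

Definition is_minimizer {R : realType} {T : Type} (X : set T) (g : T -> R)
    (x : T) : Prop :=
  X x /\ forall y, X y -> g x <= g y.

Section Problem.
Context {R : realType} {n p : nat}.
Variables (f : 'cV[R]_n -> R) (X : set 'cV[R]_n).
Variables (A : 'M[R]_(p, n)) (b : 'cV[R]_p).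

Definition residual (x : 'cV[R]_n) : 'cV[R]_p := A *m x - b.

Definition feasible_set : set 'cV[R]_n := [set x | X x /\ A *m x = b].

Definition lagrangian (lam : 'cV[R]_p) (x : 'cV[R]_n) : R :=
  f x + dot (A *m x - b) lam.

(* The infimum of the Lagrangian; it is -oo where the Lagrangian is unbounded
   below on X. *)
Definition dual_function (lam : 'cV[R]_p) : \bar R :=
  ereal_inf [set (lagrangian lam x)%:E | x in X].

Definition is_dual_optimal (lam : 'cV[R]_p) : Prop :=
  forall mu, (dual_function mu <= dual_function lam)%E.

Definition aug_lagrangian (rho : R) (lam : 'cV[R]_p) (x : 'cV[R]_n) : R :=
  f x + dot (A *m x - b) lam + rho / 2 * enorm (A *m x - b) ^+ 2.

(* xt and lam are the primal and dual iterates, xs the exact minimizers of the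
   subproblems; lam 0 is unconstrained. *)
Definition inexact_ALM (rho L : R) (D : set 'cV[R]_p)
    (ein : nat -> R) (eout : nat -> 'cV[R]_p)
    (xs xt : nat -> 'cV[R]_n) (lam : nat -> 'cV[R]_p) : Prop :=
  forall k : nat,
    [/\ is_minimizer X (aug_lagrangian rho (lam k)) (xs k),
        X (xt k),
        aug_lagrangian rho (lam k) (xt k)
          - aug_lagrangian rho (lam k) (xs k) <= ein k
      & is_projection D
          (lam k + L^-1 *: (A *m xt k - b + eout k)) (lam k.+1)].

End Problem.

Section Bounds.
Context {R : realType} {p : nat}.

Definition perturbed_set (D : set 'cV[R]_p) (eout : nat -> 'cV[R]_p) :
    set 'cV[R]_p :=
  D `|` [set mu | exists k lam, D lam /\ mu = lam + eout k].

(* Only meaningful for k >= 1, where k.-1 is the preceding index. *)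
Definition merit (L : R) (lamstar : 'cV[R]_p) (lam : nat -> 'cV[R]_p)
    (k : nat) (mu : 'cV[R]_p) : R :=
  L / 2 * enorm (lam k - mu) ^+ 2 + 1 / 2 * enorm (lam k.-1 - lamstar) ^+ 2.

Definition error_const (L Blam Bin Bout : R) : R :=
  (1 + 4 / L) * Blam * Bout + (1 + 4 / L) * Bin
    + (1 / 2 + 1 / (2 * L)) * Bout ^+ 2.

End Bounds.

Definition average {R : realType} {n : nat} (x : nat -> 'cV[R]_n) (K : nat) :
    'cV[R]_n :=
  K%:R^-1 *: \sum_(1 <= k < K.+1) x k.

(* Main.v *)
Require Import Defs.
From mathcomp Require Import all_boot all_order all_algebra.
From mathcomp Require Import all_classical all_reals.
From mathcomp Require Import interval_inference convex ereal.
From mathcomp Require Import ring lra.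

(** The dual step carries the whole argument.  Write [r_k = A x_k - b] for the
    residual of the inexact primal iterate [x_k], [e_k] for the error of the
    dual step and [d_k = |lam_(k+1) - lam_k|], and fix any multiplier [mu] of
    the box.

    Comparing [x_k] with [xstar] in the augmented Lagrangian, where the residual
    of [xstar] vanishes, gives
      [f x_k - f xstar + <r_k, lam_k> + rho/2 |r_k|^2 <= Bin].
    The variational inequality of the projection bounds
    [<r_k + e_k, mu - lam_(k+1)>] by
      [L/2 (|lam_k - mu|^2 - |lam_(k+1) - mu|^2 - d_k^2)].
    The error [e_k] costs at most [Blam * Bout] by Cauchy-Schwarz.  What is left
    is [<r_k, lam_(k+1) - lam_k>], and Young's inequality bounds it by
    [|r_k|^2 / L + L/4 d_k^2].  Since [rho/2 = 1/L], the quadratic term of the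
    augmented Lagrangian cancels the first summand, and [- L/2 d_k^2] absorbs
    the second.  This is [ALM_step]:
      [f x_k - f xstar + <r_k, mu>
         <= L/2 (|lam_k - mu|^2 - |lam_(k+1) - mu|^2) + Blam Bout + Bin].

    Summed over [k], the right-hand side telescopes, and by Jensen's inequality
    the left-hand side dominates [K] times its value at the average [xbar].
    This gives [ALM_ergodic], a bound on [f xbar - f xstar + <r xbar, mu>] for
    every [mu] of the box; its constant [Blam Bout + Bin] is a part of [E].
    Both claims follow by choosing [mu], together with the inequality
    [f xstar <= f xbar + <r xbar, lamstar>] of [saddle_point]: [mu = 0] bounds
    the objective from above, [mu = 2 lamstar] bounds [<r xbar, lamstar>] from
    above, hence the objective from below, and
    [mu = lamstar + r xbar / |r xbar|] turns [<r xbar, mu>] into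
    [<r xbar, lamstar> + |r xbar|]. *)

Import Order.TTheory GRing.Theory Num.Theory.
Local Open Scope classical_set_scope.
Local Open Scope ring_scope.
Local Open Scope convex_scope.

(** * The Euclidean inner product *)

Section Dot.
Context {R : realType} {m : nat}.
Implicit Types (u v w : 'cV[R]_m) (c : R).

Lemma dotC u v : dot u v = dot v u.
Proof. by apply: eq_bigr => i _; rewrite mulrC. Qed.

Lemma dotDl u v w : dot (u + v) w = dot u w + dot v w.
Proof. by rewrite -big_split; apply: eq_bigr => i _; rewrite mxE mulrDl. Qed.

Lemma dotZl c u v : dot (c *: u) v = c * dot u v.
Proof. by rewrite mulr_sumr; apply: eq_bigr => i _; rewrite mxE mulrA. Qed.

Lemma dotBl u v w : dot (u - v) w = dot u w - dot v w.
Proof. by rewrite dotDl -scaleN1r dotZl mulN1r. Qed.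

Lemma dotDr u v w : dot u (v + w) = dot u v + dot u w.
Proof. by rewrite dotC dotDl !(dotC u). Qed.

Lemma dotBr u v w : dot u (v - w) = dot u v - dot u w.
Proof. by rewrite dotC dotBl !(dotC u). Qed.

Lemma dotZr c u v : dot u (c *: v) = c * dot u v.
Proof. by rewrite dotC dotZl (dotC u). Qed.

Lemma dot0l v : dot 0 v = 0.
Proof. by rewrite -(scale0r 0) dotZl mul0r. Qed.

Lemma dot0r v : dot v 0 = 0.
Proof. by rewrite dotC dot0l. Qed.

Lemma dot_ge0 u : 0 <= dot u u.
Proof. by apply: sumr_ge0 => i _; rewrite -expr2 sqr_ge0. Qed.

Lemma enorm_ge0 u : 0 <= enorm u.
Proof. exact: sqrtr_ge0. Qed.

Lemma enorm_sqr u : enorm u ^+ 2 = dot u u.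
Proof. by rewrite sqr_sqrtr ?dot_ge0. Qed.

Lemma enorm_le u v : (enorm u <= enorm v) = (dot u u <= dot v v).
Proof. by rewrite ler_sqrt ?dot_ge0. Qed.

Lemma entry_le_enorm u i : `|u i 0| <= enorm u.
Proof.
rewrite -sqrtr_sqr ler_sqrt ?dot_ge0// /dot (bigD1 i)//= expr2 lerDl.
by apply: sumr_ge0 => j _; rewrite -expr2 sqr_ge0.
Qed.

Lemma enorm_eq0 u : enorm u = 0 -> u = 0.
Proof.
move=> u0; apply/matrixP => i j; rewrite ord1 mxE.
by apply/eqP; rewrite -normr_le0 -u0 entry_le_enorm.
Qed.

Lemma cauchy_schwarz u v : dot u v <= enorm u * enorm v.
Proof.
have [v0|v_neq0] := eqVneq (enorm v) 0.
  by rewrite v0 (enorm_eq0 _ v0) dot0r mulr0.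
have [u0|u_neq0] := eqVneq (enorm u) 0.
  by rewrite u0 (enorm_eq0 _ u0) dot0l mul0r.
have uv_gt0 : 0 < enorm u * enorm v by rewrite mulr_gt0// lt0r enorm_ge0 andbT.
have := dot_ge0 (enorm v *: u - enorm u *: v).
rewrite !(dotBl, dotBr, dotZl, dotZr) (dotC v u) -!enorm_sqr => sq_ge0.
rewrite -subr_ge0 -(pmulr_rge0 _ uv_gt0); lra.
Qed.

(** Young's inequality, from [0 <= |u - (c/2) v|^2]; with [c = L] the first
    weight is the one that the augmented Lagrangian can cancel. *)
Lemma dot_young c u v : 0 < c ->
  dot u v <= c^-1 * dot u u + c / 4 * dot v v.
Proof.
move=> c_gt0; have := dot_ge0 (u - (c / 2) *: v).
rewrite !(dotBl, dotBr, dotZl, dotZr) (dotC v u) => sq_ge0.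
rewrite -subr_ge0 -(pmulr_rge0 _ c_gt0).
have -> : c * (c^-1 * dot u u + c / 4 * dot v v - dot u v) =
  dot u u + c ^+ 2 / 4 * dot v v - c * dot u v by field; lra.
lra.
Qed.

End Dot.

(** * Boxes and projections *)

Lemma box_convex {R : realType} {m : nat} (lo hi : 'cV[R]_m) :
  convex_set (box lo hi).
Proof.
move=> x y t; rewrite !inE => xD yD i; rewrite !mxE.
have /andP[x1 x2] := xD i; have /andP[y1 y2] := yD i.
have t_ge0 : 0 <= t%:num by exact: ge0.
have t_le1 : t%:num <= 1 by exact: le1.
by rewrite /unstable.onem; apply/andP; split; nra.
Qed.

(** The entries of [u / |u|] lie between -1 and 1, also when [u = 0], where the
    inverse of 0 is 0. *)
Lemma box_addr_normalized {R : realType} {m : nat} (lo hi c u : 'cV[R]_m) :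
  box lo hi (c - const_mx 1) -> box lo hi (c + const_mx 1) ->
  box lo hi (c + (enorm u)^-1 *: u).
Proof.
move=> Dminus Dplus i; have := Dplus i; have := Dminus i; rewrite !mxE.
have : `|(enorm u)^-1 * u i 0| <= 1.
  have [u0|u_neq0] := eqVneq (enorm u) 0.
    by rewrite u0 invr0 mul0r normr0.
  have u_gt0 : 0 < enorm u by rewrite lt0r u_neq0 enorm_ge0.
  rewrite normrM ger0_norm ?invr_ge0 ?enorm_ge0// ler_pdivrMl// mulr1.
  exact: entry_le_enorm.
rewrite ler_norml => /andP[? ?] /andP[? ?] /andP[? ?].
by apply/andP; split; lra.
Qed.

(** Moving from the projection [v] towards a point [w] of [D] must not decrease
    the distance to [u], so its derivative in that direction is nonnegative. *)
Lemma projection_variational {R : realType} {m : nat} (D : set 'cV[R]_m)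
    (u v w : 'cV[R]_m) :
  convex_set D -> is_projection D u v -> D w -> dot (u - v) (w - v) <= 0.
Proof.
move=> D_convex [Dv v_closest] Dw.
rewrite leNgt; apply/negP.
have q_ge0 := dot_ge0 (w - v).
set c := dot (u - v) (w - v); set q := dot (w - v) (w - v) in q_ge0 * => c_gt0.
(* A step length at which the first-order gain [2 t c] exceeds the
   second-order loss [t^2 q]. *)
set t := c / (c + q).
have t_gt0 : 0 < t by rewrite divr_gt0//; lra.
have t_le1 : t <= 1 by rewrite ler_pdivrMr ?mul1r; lra.
pose t01 := Itv01 (ltW t_gt0) t_le1.
have /set_mem Dz : (w : convex_lmodType _) <| t01 |> v \in D.
  by apply: D_convex; apply/mem_set.
have := v_closest _ Dz.
have -> : u - (w : convex_lmodType _) <| t01 |> v = (u - v) - t *: (w - v).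
  rewrite /conv/= /unstable.onem scalerBl scale1r scalerBr.
  by apply/matrixP => i j; rewrite !mxE; ring.
rewrite enorm_le (dotBl (u - v)) !(dotBr _ (u - v)) !dotZl !dotZr.
rewrite (dotC (w - v) (u - v)) -/c -/q => le_t.
have : 2 * c <= t * q by rewrite -(ler_pM2l t_gt0); lra.
have tcq : t * (c + q) = c by rewrite /t divfK//; lra.
nra.
Qed.

(** * Averages *)

(** The average grows by a convex combination with the new point, which is how
    the two-point definitions of convexity reach it. *)
Lemma averageS {R : realType} {n : nat} (x : nat -> 'cV[R]_n) (K : nat) :
  (0 < K)%N ->
  average x K.+1 = (K%:R / K.+1%:R) *: average x K + K.+1%:R^-1 *: x K.+1.
Proof.
move=> K_gt0; rewrite /average big_nat_recr//= scalerDr scalerA.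
congr (_ *: _ + _).
by field; rewrite nat1r !pnatr_eq0 -lt0n K_gt0.
Qed.

Lemma jensen_average {R : realType} {n : nat} (X : set 'cV[R]_n)
    (f : 'cV[R]_n -> R) (x : nat -> 'cV[R]_n) (K : nat) :
  convex_set X -> convex_function X f -> (forall k, X (x k)) -> (0 < K)%N ->
  X (average x K) /\
  f (average x K) <= K%:R^-1 * \sum_(1 <= k < K.+1) f (x k).
Proof.
move=> X_convex f_convex Xx; elim: K => // -[_ _|K /(_ isT) [Xavg favg] _].
  by rewrite /average !big_nat1 invr1 scale1r mul1r.
set t : R := K.+1%:R / K.+2%:R.
have t_ge0 : 0 <= t by rewrite divr_ge0.
have t_le1 : t <= 1 by rewrite ler_pdivrMr// mul1r ler_nat.
pose t01 := Itv01 t_ge0 t_le1.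
have K2E : K.+2%:R^-1 = 1 - t.
  have K2_neq0 : K.+2%:R != 0 :> R by rewrite pnatr_eq0.
  apply: (mulIf K2_neq0); rewrite mulVf// mulrBl divfK// mul1r.
  by rewrite -[K.+2%:R]nat1r addrK.
have avgE : average x K.+2 =
    (average x K.+1 : convex_lmodType _) <| t01 |> x K.+2.
  by rewrite averageS// -/t K2E.
split.
  by apply/set_mem; rewrite avgE; apply: X_convex; apply/mem_set.
have := f_convex t01 _ _ (mem_set Xavg) (mem_set (Xx K.+2)).
rewrite -avgE => /le_trans; apply.
rewrite convRE/= /unstable.onem big_nat_recr//= -/t -K2E mulrDr lerD2r.
have -> : K.+2%:R^-1 = t * K.+1%:R^-1.
  by rewrite /t mulrAC divff ?mul1r// pnatr_eq0.
by rewrite -[leRHS]mulrA ler_wpM2l.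
Qed.

Lemma dot_residual_average {R : realType} {n p : nat} (A : 'M[R]_(p, n))
    (b mu : 'cV[R]_p) (x : nat -> 'cV[R]_n) (K : nat) : (0 < K)%N ->
  dot (residual A b (average x K)) mu =
  K%:R^-1 * \sum_(1 <= k < K.+1) dot (residual A b (x k)) mu.
Proof.
elim: K => // -[_ _|K /(_ isT) IH _].
  by rewrite /average !big_nat1 invr1 scale1r mul1r.
rewrite big_nat_recr//= averageS//; move: (average x K.+1) IH => y.
rewrite /residual mulmxDr -!scalemxAr => IH.
set S := \sum_(_ <= _ < _) _ in IH *.
have {}IH : S = K.+1%:R * dot (A *m y - b) mu by rewrite IH mulVKf// pnatr_eq0.
rewrite IH !dotBl dotDl !dotZl -[K.+2%:R]natr1; field.
by rewrite nat1r natr1 pnatr_eq0.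
Qed.

(** * The inexact augmented Lagrangian method *)

Section Method.
Context {R : realType} {n p : nat}.
Context {f : 'cV[R]_n -> R} {X : set 'cV[R]_n}.
Context {A : 'M[R]_(p, n)} {b : 'cV[R]_p}.

(** One half of the saddle-point property: by strong duality [f xstar] is the
    infimum over [X] of the Lagrangian at [lamstar]. *)
Lemma saddle_point (xstar x : 'cV[R]_n) (lamstar : 'cV[R]_p) :
  (f xstar)%:E = dual_function f X A b lamstar -> X x ->
  f xstar <= f x + dot (residual A b x) lamstar.
Proof.
by move=> fE Xx; rewrite -lee_fin fE; apply: ereal_inf_lbound; exists x.
Qed.

Context {D : set 'cV[R]_p} {rho L Blam Bin Bout : R}.
Context {ein : nat -> R} {eout : nat -> 'cV[R]_p}.
Context {xs xt : nat -> 'cV[R]_n} {lam : nat -> 'cV[R]_p}.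

(** The squared distance of the dual iterate to [mu] is a potential: its
    decrease pays for the excess of the Lagrangian at [mu].  The quadratic
    penalty pays for the gap between [lam k], at which the primal step is
    nearly optimal, and [lam k.+1], at which the projection is
    characterized. *)
Lemma ALM_step (xstar : 'cV[R]_n) (mu : 'cV[R]_p) (k : nat) :
  convex_set D -> 0 < rho -> L = 2 / rho ->
  inexact_ALM f X A b rho L D ein eout xs xt lam ->
  {in D &, forall mu1 mu2, enorm (mu1 - mu2) <= Blam} ->
  ein k <= Bin -> enorm (eout k) <= Bout ->
  feasible_set X A b xstar -> D mu ->
  f (xt k) - f xstar + dot (residual A b (xt k)) mu <=
  (L / 2 * enorm (lam k - mu) ^+ 2 - L / 2 * enorm (lam k.+1 - mu) ^+ 2)
  + (Blam * Bout + Bin).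
Proof.
move=> D_convex rho_gt0 L_def iterates Blam_bound ein_le eout_le.
move=> [Xxstar Axstar] Dmu.
have L_gt0 : 0 < L by rewrite L_def divr_gt0.
have [[_ xs_min] _ inexact proj] := iterates k.
have Dnext := proj.1.
have primal : aug_lagrangian f A b rho (lam k) (xt k) <= f xstar + Bin.
  have := xs_min _ Xxstar.
  rewrite [X in _ <= X -> _]/aug_lagrangian Axstar subrr enorm_sqr !dot0l; lra.
have dual := projection_variational _ _ _ _ D_convex proj Dmu.
have error : dot (eout k) (lam k.+1 - mu) <= Blam * Bout.
  apply: le_trans (cauchy_schwarz _ _) _; rewrite mulrC.
  by apply: ler_pM; rewrite ?enorm_ge0// Blam_bound// inE.
have young := dot_young _ (residual A b (xt k)) (lam k.+1 - lam k) L_gt0.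
have step_ge0 : 0 <= L / 4 * dot (lam k.+1 - lam k) (lam k.+1 - lam k).
  by rewrite mulr_ge0 ?dot_ge0// divr_ge0 ?ltW.
move: primal dual error young step_ge0.
rewrite /aug_lagrangian -/(residual _ _ _).
have -> : rho / 2 = L^-1 by rewrite L_def invf_div.
rewrite !enorm_sqr; move: (residual A b (xt k)) (eout k) => r e.
have dualE : dot (lam k + L^-1 *: (r + e) - lam k.+1) (mu - lam k.+1) =
    L^-1 * (L * dot (lam k - lam k.+1) (mu - lam k.+1)
            + dot (r + e) (mu - lam k.+1)).
  by rewrite addrAC (dotDl (lam k - _)) dotZl mulrDr mulKf ?gt_eqF.
rewrite dualE pmulr_rle0 ?invr_gt0//.
rewrite !(dotBl, dotBr, dotDl) !(dotC mu (lam _)) !(dotC (lam k.+1) (lam k)).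
lra.
Qed.

(** The average starts at the iterate with index 1, so [lam 1] gives the initial
    potential; the final one is nonnegative and drops out. *)
Lemma ALM_ergodic (xstar : 'cV[R]_n) (mu : 'cV[R]_p) (K : nat) :
  convex_set X -> convex_function X f ->
  convex_set D -> 0 < rho -> L = 2 / rho ->
  inexact_ALM f X A b rho L D ein eout xs xt lam ->
  {in D &, forall mu1 mu2, enorm (mu1 - mu2) <= Blam} ->
  (forall k, ein k <= Bin) -> (forall k, enorm (eout k) <= Bout) ->
  feasible_set X A b xstar -> D mu -> (0 < K)%N ->
  f (average xt K) - f xstar + dot (residual A b (average xt K)) mu <=
  K%:R^-1 * (L / 2 * enorm (lam 1 - mu) ^+ 2) + (Blam * Bout + Bin).
Proof.
move=> X_convex f_convex D_convex rho_gt0 L_def iterates Blam_bound.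
move=> ein_le eout_le xstar_feas Dmu K_gt0.
have Xxt k : X (xt k) by have [] := iterates k.
have [_ jensen] := jensen_average _ _ _ _ X_convex f_convex Xxt K_gt0.
rewrite dot_residual_average//.
have KR_gt0 : 0 < K%:R :> R by rewrite ltr0n.
pose V k := L / 2 * enorm (lam k - mu) ^+ 2.
have : \sum_(1 <= k < K.+1)
    (f (xt k) - f xstar + dot (residual A b (xt k)) mu) <=
  \sum_(1 <= k < K.+1) (- (V k.+1 - V k) + (Blam * Bout + Bin)).
  by apply: ler_sum_nat => k _; rewrite opprB; apply: ALM_step.
have sum_const (c : R) : \sum_(1 <= k < K.+1) c = K%:R * c.
  by rewrite sumr_const_nat subn1 mulr_natl.
rewrite !big_split/= !sumrN telescope_sumr// !sum_const => summed.
have Vend_ge0 : 0 <= V K.+1.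
  by rewrite mulr_ge0 ?sqr_ge0// L_def !divr_ge0// ltW.
move: summed jensen; set F := \sum_(_ <= _ < _) f _.
set G := \sum_(_ <= _ < _) dot _ _ => summed jensen.
apply: (@le_trans _ _ (K%:R^-1 * F - f xstar + K%:R^-1 * G)); first lra.
rewrite -(ler_pM2l KR_gt0) !(mulrDr K%:R) mulrN !mulVKf ?gt_eqF// -/(V 1%N).
lra.
Qed.

End Method.

Theorem theorem3p5 (R : realType) (n p : nat)
    (f : 'cV[R]_n -> R) (X : set 'cV[R]_n)
    (A : 'M[R]_(p, n)) (b : 'cV[R]_p)
    (X_convex : convex_set X) (f_convex : convex_function X f)
    (feasible : feasible_set X A b !=set0)
    (xstar : 'cV[R]_n)
    (xstar_opt : is_minimizer (feasible_set X A b) f xstar)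
    (lamstar : 'cV[R]_p)
    (lamstar_opt : is_dual_optimal f X A b lamstar)
    (strong_duality : (f xstar)%:E = dual_function f X A b lamstar)
    (lo hi : 'cV[R]_p)
    (D0 : box lo hi 0)
    (D2 : box lo hi (2 *: lamstar))
    (D1 : box lo hi (lamstar + const_mx 1))
    (rho L : R) (rho_gt0 : 0 < rho) (L_def : L = 2 / rho)
    (ein : nat -> R) (eout : nat -> 'cV[R]_p)
    (xs xt : nat -> 'cV[R]_n) (lam : nat -> 'cV[R]_p)
    (iterates : inexact_ALM f X A b rho L (box lo hi) ein eout xs xt lam)
    (Blam Bin Bout : R)
    (Blam_bound : forall mu1 mu2,
        perturbed_set (box lo hi) eout mu1 ->
        perturbed_set (box lo hi) eout mu2 ->
        enorm (mu1 - mu2) <= Blam)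
    (ein_bound : forall k, 0 <= ein k <= Bin)
    (eout_bound : forall k, enorm (eout k) <= Bout)
    (K : nat) (K_gt0 : (0 < K)%N) :
  let xbar := average xt K in
  let r := residual A b xbar in
  let phi1 := merit L lamstar lam 1 in
  let E := error_const L Blam Bin Bout in
  (- (K%:R^-1 * phi1 (2 *: lamstar) + E) <= f xbar - f xstar
     <= K%:R^-1 * phi1 0 + E)
  /\
  (box lo hi (lamstar - const_mx 1) ->
   enorm r <= K%:R^-1 * phi1 (lamstar + (enorm r)^-1 *: r) + E).
Proof.
move=> xbar r phi1 E.
have xstar_feas := xstar_opt.1.
have L_gt0 : 0 < L by rewrite L_def divr_gt0.
have Bin_ge0 : 0 <= Bin by have /andP[] := ein_bound 0; apply: le_trans.
have Bout_ge0 : 0 <= Bout := le_trans (enorm_ge0 _) (eout_bound 0).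
have Blam_box : {in box lo hi &, forall mu1 mu2, enorm (mu1 - mu2) <= Blam}.
  by move=> mu1 mu2; rewrite !inE => Dmu1 Dmu2; apply: Blam_bound; left.
have Blam_ge0 : 0 <= Blam.
  by apply: le_trans (enorm_ge0 (0 - 0)) (Blam_box _ _ _ _); rewrite inE.
have Xxt k : X (xt k) by have [] := iterates k.
have [Xxbar _] := jensen_average _ _ _ _ X_convex f_convex Xxt K_gt0.
have saddle := saddle_point _ _ _ strong_duality Xxbar.
have bound mu : box lo hi mu ->
    f xbar - f xstar + dot r mu <= K%:R^-1 * phi1 mu + E.
  move=> Dmu; have ein_le k : ein k <= Bin by have /andP[] := ein_bound k.
  have := ALM_ergodic _ _ _ X_convex f_convex (box_convex lo hi)
    rho_gt0 L_def iterates Blam_box ein_le eout_bound xstar_feas Dmu K_gt0.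
  move=> /le_trans; apply; rewrite /phi1 /merit mulrDr -addrA lerD2l.
  (* [E] exceeds the constant of [ALM_ergodic] by nonnegative terms, and
     [phi1 mu] exceeds the potential at [lam 1] by the term in [lam 0]. *)
  have -> : E = Blam * Bout + Bin + (4 / L * (Blam * Bout) + 4 / L * Bin
      + (1 / 2 + 1 / (2 * L)) * Bout ^+ 2) by rewrite /E /error_const; ring.
  have extra_ge0 : 0 <= 4 / L * (Blam * Bout) + 4 / L * Bin
      + (1 / 2 + 1 / (2 * L)) * Bout ^+ 2.
    have L_ge0 := ltW L_gt0.
    have quot_ge0 : 0 <= 4 / L by rewrite divr_ge0.
    apply: addr_ge0; first by rewrite addr_ge0 ?(mulr_ge0 quot_ge0) ?mulr_ge0.
    by rewrite mulr_ge0 ?sqr_ge0// addr_ge0 ?divr_ge0 ?mulr_ge0.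
  have : 0 <= K%:R^-1 * (1 / 2 * enorm (lam 1.-1 - lamstar) ^+ 2).
    by rewrite mulr_ge0 ?invr_ge0// mulr_ge0 ?sqr_ge0.
  lra.
split.
  have := bound _ D0; have := bound _ D2; rewrite dot0r dotZr.
  by move: saddle; rewrite -/xbar -/r => ? ? ?; apply/andP; split; lra.
move=> Dminus.
have Dmu := box_addr_normalized _ _ _ r Dminus D1.
have := bound _ Dmu; rewrite dotDr dotZr -enorm_sqr.
have -> : (enorm r)^-1 * enorm r ^+ 2 = enorm r.
  have [->|r_neq0] := eqVneq (enorm r) 0; first by rewrite expr0n mulr0.
  by rewrite expr2 mulKf.
move: saddle; rewrite -/xbar -/r; lra.
Qed.
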